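(* Let $(A,B)$ be an infinitesimally rigid nonnegative rank-$r$ factorization, where $A\in\mathbb{R}^{m\times r}_{\ge 0}$ and $B\in\mathbb{R}^{r\times n}_{\ge 0}$. Then: (i) $A$ and $B$ have at least $r^2-r+1$ zero entries in total; and (ii) for every ordered pair of distinct indices $i,j\in\{1,\dots,r\}$ there is a row of $A$ with a zero in position $i$ and a nonzero entry in position $j$, and there is a column of $B$ with a zero in position $i$ and a nonzero entry in position $j$.
   Context: Here $m,n,r$ are positive integers, and inequalities between matrices are entrywise. A nonnegative rank-$r$ factorization is a pair $(A,B)$ with $A\in\mathbb{R}^{m\times r}_{\ge 0}$, $B\in\mathbb{R}^{r\times n}_{\ge 0}$ and $\operatorname{rank}(AB)=r$. An infinitesimal motion of $(A,B)$ is a pair $(\dot A,\dot B)\in\mathbb{R}^{m\times r}\times\mathbb{R}^{r\times n}$ with $A\dot B+\dot A B=0$ such that for some $\epsilon>0$ one has $A+t\dot A\ge 0$ and $B+t\dot B\ge 0$ for all $t\in[0,\epsilon)$. The motion is trivial if $\dot A=AD$ and $\dot B=-DB$ for some diagonal $D\in\mathbb{R}^{r\times r}$. The factorization $(A,B)$ is infinitesimally rigid if all of its infinitesimal motions are trivial.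
   Formalization: Part (i) is stated only for r ≥ 2: for r = 1 it fails, since A = B = (1) is an infinitesimally rigid rank-1 factorization with no zero entries, whereas the bound would require at least one. *)

(* Defs.v *)
From mathcomp Require Import all_boot all_order all_algebra.
From mathcomp Require Import reals.

Set Implicit Arguments.
Unset Strict Implicit.
Unset Printing Implicit Defensive.

Import Order.TTheory GRing.Theory Num.Theory.
Local Open Scope ring_scope.

Definition nonneg_mx (R : realType) (p q : nat) (M : 'M[R]_(p, q)) : Prop :=
  forall i j, 0 <= M i j.

Definition nonneg_rank_factorization (R : realType) (m n r : nat)
    (A : 'M[R]_(m, r)) (B : 'M[R]_(r, n)) : Prop :=
  [/\ nonneg_mx A, nonneg_mx B & \rank (A *m B) = r].

Definition infinitesimal_motion (R : realType) (m n r : nat)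
    (A : 'M[R]_(m, r)) (B : 'M[R]_(r, n))
    (dA : 'M[R]_(m, r)) (dB : 'M[R]_(r, n)) : Prop :=
  A *m dB + dA *m B = 0 /\
  exists2 eps : R, 0 < eps &
    forall t : R, 0 <= t -> t < eps ->
      nonneg_mx (A + t *: dA) /\ nonneg_mx (B + t *: dB).

Definition trivial_motion (R : realType) (m n r : nat)
    (A : 'M[R]_(m, r)) (B : 'M[R]_(r, n))
    (dA : 'M[R]_(m, r)) (dB : 'M[R]_(r, n)) : Prop :=
  exists d : 'rV[R]_r, dA = A *m diag_mx d /\ dB = - (diag_mx d *m B).

Definition infinitesimally_rigid (R : realType) (m n r : nat)
    (A : 'M[R]_(m, r)) (B : 'M[R]_(r, n)) : Prop :=
  forall (dA : 'M[R]_(m, r)) (dB : 'M[R]_(r, n)),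
    infinitesimal_motion A B dA dB -> trivial_motion A B dA dB.

Definition num_zeros (R : realType) (p q : nat) (M : 'M[R]_(p, q)) : nat :=
  #|[set ij : 'I_p * 'I_q | M ij.1 ij.2 == 0]|.

(* Main.v *)
Require Import Defs.
From HB Require Import structures.
From mathcomp Require Import all_boot all_order all_algebra.
From mathcomp Require Import reals.

(** For every r x r matrix X the pair (A X, - X B) satisfies the linearized
    equation A dB + dA B = 0, and it is a motion as soon as (A X) is
    nonnegative at the zeros of A and X B is nonpositive at the zeros of B:
    at a positive entry a short enough move cannot break nonnegativity.  Since
    A has full column rank, such a motion is trivial only if X is diagonal.
    Rigidity therefore says that the polyhedral cone of matrices X cut out by
    these sign conditions, one per zero entry, contains only diagonal matrices
    ([rigid_diagonal]).

    Part (ii) tests this with X a signed elementary matrix: X = - E_ji violates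
    the sign conditions only at a row of A with a zero in position i and a
    nonzero entry in position j, and X = E_ij only at a column of B of the same
    kind.  Neither matrix is diagonal, so such a row and such a column exist.

    Part (i) is a dimension count.  The matrices X with zero diagonal form a
    space of dimension r^2 - r, positive for r > 1, on which the sign conditions
    must have no nonzero solution.  But at most d homogeneous linear inequalities in d > 0
    unknowns always have one: either the functionals have a nonzero common kernel, or
    they form a basis of the dual space and can all be given the value 1
    ([nonneg_solution]). *)

Set Implicit Arguments.
Unset Strict Implicit.
Unset Printing Implicit Defensive.

Import Order.TTheory GRing.Theory Num.Theory.
Local Open Scope ring_scope.

(** The equations [u *m G = 0] bring the number of unknowns down to [d - e] or
    more; the two cases of the proof are whether the [N + e] functionals have
    a nonzero common kernel or separate points. *)
Lemma nonneg_solution (K : numFieldType) (d N e : nat)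
    (F : 'M[K]_(d, N)) (G : 'M[K]_(d, e)) :
  (e < d)%N -> (N + e <= d)%N ->
  exists u : 'rV[K]_d,
    [/\ u != 0, u *m G = 0 & forall q, 0 <= (u *m F) 0 q].
Proof.
move=> lt_ed le_Ned; pose M := row_mx F G.
have [freeM | nfreeM] := boolP (row_free M); last first.
  have : kermx M != 0 by rewrite kermx_eq0.
  case/rowV0Pn=> u /sub_kermxP; rewrite mul_mx_row -[0]row_mx0.
  by case/eq_row_mx=> uF0 uG0 u_neq0; exists u; split=> // q; rewrite uF0 mxE.
have rkM : \rank M = d by apply/eqP.
have defNe : (N + e)%N = d.
  by apply/eqP; rewrite eqn_leq le_Ned -[leqLHS]rkM rank_leq_col.
have fullM : row_full M by rewrite /row_full rkM defNe.
have N_gt0 : (0 < N)%N by rewrite -(ltn_add2r e) defNe.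
pose w : 'rV[K]_(N + e) := row_mx (const_mx 1) 0.
have [u] := submxP (submx_full w fullM).
rewrite mul_mx_row => /eq_row_mx[defF defG].
exists u; split=> [||q]; rewrite -?defF -?defG ?mxE ?ler01 //.
apply/eqP=> u0; move/rowP/(_ (Ordinal N_gt0)): defF.
by rewrite u0 mul0mx !mxE => /eqP; rewrite oner_eq0.
Qed.

Lemma nonneg_perturbation (R : realType) (p q : nat) (M dM : 'M[R]_(p, q)) :
  nonneg_mx M -> (forall i j, M i j = 0 -> 0 <= dM i j) ->
  exists2 eps : R, 0 < eps &
    forall t, 0 <= t -> t < eps -> nonneg_mx (M + t *: dM).
Proof.
move=> M_ge0 dM_ge0.
(* The inverse of a sum bounds the minimum of the ratios M / |dM| from below;
   where M vanishes, the convention x / 0 = 0 makes the term harmless. *)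
pose ratio (ij : 'I_p * 'I_q) := `|dM ij.1 ij.2| / M ij.1 ij.2.
have ratio_ge0 ij : 0 <= ratio ij by rewrite divr_ge0.
have sum_ge0 (P : pred _) : 0 <= \sum_(ij | P ij) ratio ij by apply: sumr_ge0.
pose s := 1 + \sum_ij ratio ij.
have s_gt0 : 0 < s by rewrite ltr_wpDr ?ltr01 ?sum_ge0.
exists s^-1; first by rewrite invr_gt0.
move=> t t_ge0 lt_t i j; rewrite !mxE.
have [Mij0 | Mij_neq0] := eqVneq (M i j) 0.
  by rewrite Mij0 add0r mulr_ge0 ?dM_ge0.
have Mij_gt0 : 0 < M i j by rewrite lt_def Mij_neq0 M_ge0.
have le_ratio : ratio (i, j) <= s.
  rewrite /s (bigD1 (i, j)) //= addrCA lerDl.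
  by rewrite addr_ge0 ?ler01 ?sum_ge0.
have le_tdM : t * `|dM i j| <= M i j.
  rewrite -[leRHS]mul1r -ler_pdivrMr // -mulrA -(mulVf (lt0r_neq0 s_gt0)).
  by apply: ler_pM => //; [apply: ratio_ge0 (i, j) | apply: ltW].
rewrite -[t * _]opprK subr_ge0; apply: le_trans le_tdM.
by rewrite -mulrN ler_wpM2l // -normrN ler_norm.
Qed.

Section Rigidity.

Variables (R : realType) (m n r : nat).
Variables (A : 'M[R]_(m, r)) (B : 'M[R]_(r, n)).
Hypothesis fact_AB : nonneg_rank_factorization A B.

Lemma factorization_row_full : row_full A.
Proof.
case: fact_AB => _ _ rkAB; rewrite /row_full eqn_leq rank_leq_col /=.
by rewrite -[leqLHS]rkAB mxrankM_maxl.
Qed.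

Lemma motion_of_mx (X : 'M[R]_r) :
  (forall k i, A k i = 0 -> 0 <= (A *m X) k i) ->
  (forall i l, B i l = 0 -> (X *m B) i l <= 0) ->
  infinitesimal_motion A B (A *m X) (- (X *m B)).
Proof.
case: fact_AB => A_ge0 B_ge0 _ AX_ge0 XB_le0; split.
  by rewrite mulmxN mulmxA addNr.
have [e1 e1_gt0 e1P] := nonneg_perturbation A_ge0 AX_ge0.
have [i l Bil0 | e2 e2_gt0 e2P] :=
  @nonneg_perturbation _ _ _ B (- (X *m B)) B_ge0.
  by rewrite mxE oppr_ge0 XB_le0.
exists (Num.min e1 e2); first by rewrite lt_min e1_gt0.
by move=> t t_ge0; rewrite lt_min => /andP[lt1 lt2]; split; auto.
Qed.

Hypothesis rigid_AB : infinitesimally_rigid A B.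

(** Triviality of the motion gives A X = A D with D diagonal, and A is
    left-cancellable. *)
Lemma rigid_diagonal (X : 'M[R]_r) :
  (forall k i, A k i = 0 -> 0 <= (A *m X) k i) ->
  (forall i l, B i l = 0 -> (X *m B) i l <= 0) ->
  forall i j, i != j -> X i j = 0.
Proof.
move=> AX_ge0 XB_le0 i j neq_ij.
have [d [/(row_full_inj factorization_row_full) -> _]] :=
  rigid_AB (motion_of_mx AX_ge0 XB_le0).
by rewrite mxE (negPf neq_ij) mulr0n.
Qed.

Lemma mulmx_delta_entry (p : nat) (M : 'M[R]_(p, r)) (i j : 'I_r) k l :
  (M *m delta_mx i j) k l = M k i *+ (l == j).
Proof.
rewrite mxE (bigD1 i) //= big1 => [|a neq_ai].
  by rewrite mxE eqxx /= addr0 mulr_natr.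
by rewrite mxE (negPf neq_ai) mulr0.
Qed.

Lemma delta_mulmx_entry (p : nat) (M : 'M[R]_(r, p)) (i j : 'I_r) k l :
  (delta_mx i j *m M) k l = M j l *+ (k == i).
Proof.
rewrite mxE (bigD1 j) //= big1 => [|a neq_aj].
  by rewrite mxE eqxx andbT addr0 mulr_natl.
by rewrite mxE (negPf neq_aj) andbF mul0r.
Qed.

(** Otherwise X = - E_ji, which subtracts column j of A from column i and adds
    row i of B to row j, would meet all the sign conditions. *)
Lemma rigid_row_witness (i j : 'I_r) :
  i != j -> exists k, A k i = 0 /\ A k j != 0.
Proof.
move=> neq_ij; have [_ B_ge0 _] := fact_AB.
have [/existsP[k /andP[/eqP Aki0 Akj]] | none] :=
  boolP [exists k, (A k i == 0) && (A k j != 0)]; first by exists k.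
have AX k a : A k a = 0 -> 0 <= (A *m - delta_mx j i) k a.
  rewrite mulmxN mxE mulmx_delta_entry.
  have [-> Aki0 | _ _] := eqVneq a i; last by rewrite oppr0.
  move: none; rewrite negb_exists => /forallP/(_ k).
  by rewrite Aki0 eqxx /= negbK => /eqP ->; rewrite mul0rn oppr0.
have XB a l : B a l = 0 -> ((- delta_mx j i) *m B) a l <= 0.
  by rewrite mulNmx mxE delta_mulmx_entry oppr_le0 mulrn_wge0.
have neq_ji : j != i by rewrite eq_sym.
have /eqP := rigid_diagonal AX XB neq_ji.
by rewrite !mxE !eqxx oppr_eq0 oner_eq0.
Qed.

(** Otherwise X = E_ij, which adds column i of A to column j and subtracts
    row j of B from row i, would meet all the sign conditions. *)
Lemma rigid_col_witness (i j : 'I_r) :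
  i != j -> exists l, B i l = 0 /\ B j l != 0.
Proof.
move=> neq_ij; have [A_ge0 _ _] := fact_AB.
have [/existsP[l /andP[/eqP Bil0 Bjl]] | none] :=
  boolP [exists l, (B i l == 0) && (B j l != 0)]; first by exists l.
have AX k a : A k a = 0 -> 0 <= (A *m delta_mx i j) k a.
  by rewrite mulmx_delta_entry mulrn_wge0.
have XB a l : B a l = 0 -> (delta_mx i j *m B) a l <= 0.
  rewrite delta_mulmx_entry.
  have [-> Bil0 | _ //] := eqVneq a i.
  move: none; rewrite negb_exists => /forallP/(_ l).
  by rewrite Bil0 eqxx /= negbK => /eqP ->.
have /eqP := rigid_diagonal AX XB neq_ij.
by rewrite !mxE !eqxx oner_eq0.
Qed.

Let ZA := [set ki : 'I_m * 'I_r | A ki.1 ki.2 == 0].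
Let ZB := [set il : 'I_r * 'I_n | B il.1 il.2 == 0].

Let signs (X : 'M[R]_r) : 'rV[R]_(#|ZA| + #|ZB|) :=
  row_mx (\row_q (A *m X) (enum_val q).1 (enum_val q).2)
         (\row_q (- (X *m B)) (enum_val q).1 (enum_val q).2).

Let signs_linear : linear signs.
Proof.
move=> a X Y; rewrite /signs scale_row_mx add_row_mx.
congr row_mx; apply/rowP=> q.
  by rewrite mxE linearP !mxE.
by rewrite mxE mulmxDl -scalemxAl !mxE opprD mulrN.
Qed.
HB.instance Definition _ :=
  GRing.isLinear.Build R 'M[R]_r 'rV[R]_(#|ZA| + #|ZB|) _ signs signs_linear.

Let diagonal (X : 'M[R]_r) : 'rV[R]_r := \row_i X i i.

Let diagonal_linear : linear diagonal.
Proof. by move=> a X Y; apply/rowP=> i; rewrite !mxE. Qed.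
HB.instance Definition _ :=
  GRing.isLinear.Build R 'M[R]_r 'rV[R]_r _ diagonal diagonal_linear.

(** With at most r^2 - r zeros, the r^2 entries of X would have room for r
    equations (zero diagonal) and all the sign conditions, yielding a nonzero
    X that rigidity forces to vanish off the diagonal as well. *)
Lemma rigid_num_zeros :
  (1 < r)%N -> (r ^ 2 - r < num_zeros A + num_zeros B)%N.
Proof.
move=> r_gt1; rewrite ltnNge; apply/negP=> few_zeros.
have r_lt : (r < r * r)%N by rewrite ltn_Pmulr // ltnW.
have room : (#|ZA| + #|ZB| + r <= r * r)%N.
  by rewrite addnC -leq_subRL ?(ltnW r_lt) // mulnn.
have [u [u_neq0 diag0 signs_ge0]] :=
  nonneg_solution (lin1_mx (signs \o vec_mx)) (lin1_mx (diagonal \o vec_mx))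
    r_lt room.
rewrite mul_rV_lin1 /= in diag0.
have {}signs_ge0 q : 0 <= signs (vec_mx u) 0 q.
  by have := signs_ge0 q; rewrite mul_rV_lin1.
set X := vec_mx u in diag0 signs_ge0.
have AX k i : A k i = 0 -> 0 <= (A *m X) k i.
  move=> Aki0; have kiZ : (k, i) \in ZA by rewrite inE /= Aki0.
  have := signs_ge0 (lshift _ (enum_rank_in kiZ (k, i))).
  by rewrite row_mxEl mxE enum_rankK_in.
have XB i l : B i l = 0 -> (X *m B) i l <= 0.
  move=> Bil0; have ilZ : (i, l) \in ZB by rewrite inE /= Bil0.
  have := signs_ge0 (rshift _ (enum_rank_in ilZ (i, l))).
  by rewrite row_mxEr mxE enum_rankK_in // mxE oppr_ge0.
case/eqP: u_neq0; apply: (can_inj vec_mxK); rewrite linear0.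
apply/matrixP=> i j; rewrite [RHS]mxE.
have [-> | neq_ij] := eqVneq i j; last exact: rigid_diagonal.
by move/rowP/(_ j): diag0; rewrite !mxE.
Qed.

End Rigidity.

(* For r = 1 every factorization is infinitesimally rigid, e.g. A = B = (1)
   with no zero entry, so the bound in (i) requires r >= 2; (ii) does not. *)
Theorem theorem3p4 (R : realType) (m n r : nat)
    (m_gt0 : (0 < m)%N) (n_gt0 : (0 < n)%N) (r_gt0 : (0 < r)%N)
    (A : 'M[R]_(m, r)) (B : 'M[R]_(r, n))
    (fact_AB : nonneg_rank_factorization A B)
    (rigid_AB : infinitesimally_rigid A B) :
  ((1 < r)%N -> (r ^ 2 - r + 1 <= num_zeros A + num_zeros B)%N) /\
  (forall i j : 'I_r, i != j ->
     (exists k : 'I_m, A k i = 0 /\ A k j != 0) /\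
     (exists l : 'I_n, B i l = 0 /\ B j l != 0)).
Proof.
split=> [r_gt1 | i j neq_ij].
  by rewrite addn1; apply: rigid_num_zeros.
by split; [apply: (rigid_row_witness fact_AB) | apply: (rigid_col_witness fact_AB)].
Qed.
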